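(* Let $n$ be a positive integer, let $H=(\mathbb{Z}\times\mathbb{Z}_{\geq 0})\setminus(\mathbb{Z}_{<0}\times\{0\})$, and let $B_n=\{(x,y): x,y\in H,\ \det(x\ y)=n\}$. Then $$\sum_{(x,y)\in B_n}\frac{n^2}{|x|^2\,|y|^2\,|x+y|^2}=\frac{1}{2}\cdot\frac{\pi}{n}\cdot\sigma_1(n),$$ where $\sigma_1(n)$ is the sum of the positive divisors of $n$.
   Context: For $x,y\in\mathbb{R}^2$, $(x\ y)$ denotes the $2\times 2$ matrix with columns $x$ and $y$, and $|\cdot|$ is the Euclidean norm on $\mathbb{R}^2$. *)

(* Defs.v *)
From HB Require Import structures.
From mathcomp Require Import all_boot all_order all_algebra.
From mathcomp Require Import all_classical all_reals all_analysis.
Set Implicit Arguments.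
Unset Strict Implicit.
Unset Printing Implicit Defensive.
Import Order.TTheory GRing.Theory Num.Theory.

Local Open Scope classical_set_scope.
Local Open Scope ring_scope.

(* The library norm on matrices is the sup norm, hence this definition. *)
Definition enorm (R : realType) (v : 'cV[R]_2) : R :=
  Num.sqrt (\sum_(i < 2) v i 0 ^+ 2).

Definition toR (R : realType) (x : 'cV[int]_2) : 'cV[R]_2 := map_mx intr x.

Definition H : set 'cV[int]_2 :=
  [set x | 0 <= x 1 0] `\` [set x | x 0 0 < 0 /\ x 1 0 = 0].

Definition B (n : nat) : set ('cV[int]_2 * 'cV[int]_2) :=
  [set p | [/\ H p.1, H p.2 & \det (row_mx p.1 p.2 : 'M[int]_2) = n%:Z]].

Definition sigma1 (n : nat) : nat := (\sum_(d <- divisors n) d)%N.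

(* Main.v *)
(* Let theta be the angle from x to y.  The function E(x, y) = theta - sin theta cos theta
   satisfies E(x, y) - E(x, x + y) - E(x + y, y) = 2 n w(x, y), where n = det(x y) and w
   is the summand.  Iterating (x, y) -> (x, x + y), (x + y, y) therefore gives a binary
   tree of pairs whose weights add up to E(root) / 2n: the angles at depth k add up to
   the angle of the root, and each of them tends to 0 with k.

   The Euclidean algorithm, run backwards from pairs with x on the horizontal axis,
   reaches every pair of B_n exactly once, so the sum reduces to one of
   E(x, y) - E(x, x + y) over x = (a, 0), y = (j, n / a), with a | n and j an integer.
   For fixed a this telescopes in j, with step a, from pi down to 0, and contributes
   a pi / 2n. *)
Require Import Defs.
From HB Require Import structures.
From mathcomp Require Import all_boot all_order all_algebra.
From mathcomp Require Import all_classical all_reals all_analysis.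
From mathcomp Require Import ring lra zify.
Set Implicit Arguments.
Unset Strict Implicit.
Unset Printing Implicit Defensive.
Import Order.TTheory GRing.Theory Num.Theory.
Import numFieldNormedType.Exports.
Local Open Scope classical_set_scope.
Local Open Scope ring_scope.

(** * Arccotangent and the excess of an angle *)

(** The branch with values in the open interval from 0 to pi, where the angle of a pair with
    positive determinant lies. *)
Definition acot (R : realType) (t : R) : R := pi / 2 - atan t.

(* With [t = cot theta], this is [theta - sin theta * cos theta]. *)
Definition excess (R : realType) (t : R) : R := acot t - t / (1 + t ^+ 2).

Lemma acot_gt0 (R : realType) (t : R) : 0 < acot t.
Proof. by rewrite subr_gt0 atan_ltpi2. Qed.

Lemma acotN (R : realType) (t : R) : acot (- t) = pi - acot t.
Proof. by rewrite /acot atanN; lra. Qed.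

Lemma excessN (R : realType) (t : R) : excess (- t) = pi - excess t.
Proof. by rewrite /excess acotN sqrrN mulNr; lra. Qed.

(** The addition formula for the cotangent. Positivity of [u + v] says that the two angles add up to
    less than pi, so the sum stays on the branch. *)
Lemma acotD (R : realType) (u v : R) : 0 < u + v ->
  acot u + acot v = acot ((u * v - 1) / (u + v)).
Proof.
move=> uv.
rewrite /acot.
suff <- : atan u + atan v - pi / 2 = atan ((u * v - 1) / (u + v)) by lra.
have bnd (w : R) : - (pi / 2) < atan w < pi / 2.
  by rewrite atan_gtNpi2 atan_ltpi2.
have Nvu : - atan v < atan u by rewrite -atanN lt_atan//; lra.
have /andP[_ u2] := bnd u; have /andP[_ v2] := bnd v.
have cosn0 (w : R) : cos (atan w) != 0.
  by rewrite gt_eqF// cos_gt0_pihalf// bnd.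
have sinE (w : R) : sin (atan w) = cos (atan w) * w.
  by apply/esym; rewrite -{2}[w]atanK /tan mulrC divfK.
rewrite -[LHS]tanK; last by rewrite in_itv/=; apply/andP; split; lra.
congr atan; rewrite /tan sinB cosB sin_pihalf cos_pihalf !mulr0 !mulr1.
rewrite !add0r sinD cosD !sinE.
(* Expanding the right-hand fraction by the product of the two cosines matches it with the quotient
   of sine and cosine on the left. *)
have cc := divff (mulf_neq0 (cosn0 u) (cosn0 v)).
rewrite -[RHS]mul1r -[X in _ = X * _]cc mulf_div.
by congr (_ / _); ring.
Qed.

Lemma acotV (R : realType) (t : R) : 0 < t -> acot t = atan t^-1.
Proof.
move=> t0; have Vt0 : 0 < t^-1 by rewrite invr_gt0.
have := @acotD R t^-1 t; rewrite mulVf ?gt_eqF// subrr mul0r => /(_ _).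
rewrite {2 3}/acot atan0; move=> /(_ ltac:(lra)).
by rewrite /acot; lra.
Qed.

(** By the mean value theorem [atan s] is [s / (1 + c ^+ 2)] for some [c] between 0 and [s]. *)
Lemma atan_bounds (R : realType) (s : R) : 0 < s ->
  s / (1 + s ^+ 2) <= atan s <= s.
Proof.
move=> s0.
have datan z : z \in `]0, s[%R -> is_derive z (1 : R) atan (1 + z ^+ 2)^-1.
  by move=> _; exact: is_derive1_atan.
have catan : {within `[0, s], continuous (@atan R)}.
  by apply: derivable_within_continuous => z _; exact: derivable_atan.
have [c] := MVT s0 datan catan.
rewrite in_itv/= atan0 !subr0 => /andP[c0 cs] ->.
rewrite mulrC ler_pM2r// ler_piMl ?(ltW s0)//.
  rewrite lef_pV2 ?posrE ?ltr_pwDl ?sqr_ge0// lerD2l andbT.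
  by rewrite lerXn2r ?nnegrE ?ltW.
by rewrite invf_le1 ?ltr_pwDl ?sqr_ge0// lerDl sqr_ge0.
Qed.

(** Both bounds come from [atan_bounds] at [t^-1]. The upper one is the angle times a small factor:
    since angles are additive, it can be summed over a whole level of the tree. *)
Lemma excess_bounds (R : realType) (t : R) : 0 < t ->
  0 <= excess t <= acot t / t.
Proof.
move=> t0; have Vt0 : 0 < t^-1 by rewrite invr_gt0.
have /andP[lo hi] := atan_bounds Vt0.
move: lo hi; rewrite -acotV// => lo hi.
have tE : t^-1 / (1 + t^-1 ^+ 2) = t / (1 + t ^+ 2).
  by field; rewrite !gt_eqF ?ltr_pwDl ?sqr_ge0.
have d0 : 0 < 1 + t ^+ 2 by rewrite ltr_pwDl ?sqr_ge0.
rewrite /excess subr_ge0 -tE lo/= tE.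
apply: (@le_trans _ _ (acot t / (1 + t ^+ 2))).
  suff : acot t * t ^+ 2 / (1 + t ^+ 2) <= t / (1 + t ^+ 2).
    have -> : acot t * t ^+ 2 / (1 + t ^+ 2) = acot t - acot t / (1 + t ^+ 2).
      by field; rewrite gt_eqF.
    lra.
  rewrite ler_pM2r ?invr_gt0//.
  have ht : acot t * t <= 1 by rewrite -ler_pdivlMr// mul1r.
  by nra.
rewrite ler_pM2l ?acot_gt0// lef_pV2 ?posrE//; nra.
Qed.

Lemma excess_cvg0 (R : realType) (d : R) (c : int) : 0 < d ->
  excess (d * (k%:Z + c)%:~R) @[k --> \oo] --> (0 : R).
Proof.
move=> d0; rewrite -(cvg_shiftn `|c|.+1%N).
apply: (@squeeze_cvgr _ _ _ _ (cst 0) (fun k => pi / d * harmonic k)).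
- near=> k => /=.
  have k0 : (0 : R) < k.+1%:R by rewrite ltr0n.
  have le : k.+1%:R <= ((k + `|c|.+1)%N%:Z + c)%:~R :> R.
    by rewrite -[k.+1%:R]/(k.+1%:Z%:~R) ler_int; lia.
  have t0 : 0 < d * ((k + `|c|.+1)%N%:Z + c)%:~R.
    by rewrite mulr_gt0// (lt_le_trans k0).
  have /andP[-> hi] := excess_bounds t0.
  apply: le_trans hi _; rewrite invfM mulrA.
  apply: ler_pM.
  + by rewrite divr_ge0 ?ltW ?acot_gt0.
  + by rewrite invr_ge0 (le_trans (ltW k0)).
  + rewrite ler_pM2r ?invr_gt0//.
    (* Positivity at the opposite argument gives the upper bound pi for [acot]. *)
    have := acot_gt0 (- (d * ((k + `|c|.+1)%N%:Z + c)%:~R)).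
    by rewrite acotN subr_gt0 => /ltW.
  + by rewrite /harmonic/= lef_pV2 ?posrE// (lt_le_trans k0).
- exact: cvg_cst.
- rewrite -[X in _ --> X](mulr0 (pi / d)).
  apply: cvgMr; exact: cvg_harmonic.
Unshelve. all: by end_near. Qed.

(** * Telescoping sums over the naturals and the integers *)

Lemma esum_telescope_nat (R : realType) (u : nat -> R) (l : R) :
  (forall k, u k.+1 <= u k) -> u k @[k --> \oo] --> l ->
  (\esum_(k in setT) (u k - u k.+1)%:E = (u 0%N - l)%:E)%E.
Proof.
move=> du cu; rewrite -nneseries_esumT; last first.
  by move=> k; rewrite lee_fin subr_ge0.
apply/cvg_lim => //.
have -> : (fun m => \sum_(0 <= k < m) (u k - u k.+1)%:E)%E =
          (fun m => (u 0%N - u m)%:E).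
  apply/funext => m; rewrite sumEFin; congr EFin.
  elim: m => [|m IH]; first by rewrite big_nil subrr.
  by rewrite big_nat_recr//= IH; lra.
by apply: cvg_EFin; [exact: nearW|apply: cvgB => //; exact: cvg_cst].
Qed.

(** The sum is cut at 0. The half [j = - (k + 1)] telescopes along the sequence [- u (- k)], and the
    two values [u 0] cancel. *)
Lemma esum_telescope_int (R : realType) (u : int -> R) (l l' : R) :
  (forall j, u (j + 1) <= u j) ->
  u k%:Z @[k --> \oo] --> l -> u (- k%:Z) @[k --> \oo] --> l' ->
  (\esum_(j in setT) (u j - u (j + 1))%:E = (l' - l)%:E)%E.
Proof.
move=> du cu cu'; rewrite (esumID [set j | 0 <= j]); last first.
  by move=> j _; rewrite lee_fin subr_ge0.
rewrite !setTI.
rewrite (reindex_esum setT _ Posz); last first.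
  split; [by move=> k _|by move=> i j _ _ []|].
  by case=> k //= _; exists k.
rewrite (reindex_esum setT (~` _) Negz); last first.
  split; [by move=> k _|by move=> i j _ _ []|].
  by case=> k //= H; exists k.
rewrite (eq_esum (b := fun k => (u k%:Z - u k.+1%:Z)%:E)); last first.
  by move=> k _; congr (u _ - u _)%:E; lia.
rewrite (esum_telescope_nat _ cu); last first.
  by move=> k; have := du k; rewrite (_ : k%:Z + 1 = k.+1)//; lia.
rewrite (eq_esum (b := fun k => (- u (- k%:Z) - - u (- k.+1%:Z))%:E)); last first.
  move=> k _; rewrite opprK addrC NegzE.
  by congr (- u _ + _)%:E; lia.
rewrite (@esum_telescope_nat _ (fun k => - u (- k%:Z)) (- l')); last 2 first.
- move=> k; rewrite lerN2; have := du (- k.+1%:Z).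
  by rewrite (_ : - k.+1%:Z + 1 = - k%:Z)//; lia.
- exact: cvgN.
by rewrite oppr0 -EFinD; congr EFin; lra.
Qed.

(* Summing [u] over windows of length [a] turns a step of [a] into a step of 1. *)
Lemma esum_telescope_step (R : realType) (a : nat) (u : int -> R) (l l' : R) :
  (forall j, u (j + a%:Z) <= u j) ->
  (forall c, u (k%:Z + c) @[k --> \oo] --> l) ->
  (forall c, u (- k%:Z + c) @[k --> \oo] --> l') ->
  (\esum_(j in setT) (u j - u (j + a%:Z))%:E = (a%:R * (l' - l))%:E)%E.
Proof.
move=> du cu cu'.
pose v j := \sum_(i < a) u (j + i%:Z).
have vE j : u j - u (j + a%:Z) = v j - v (j + 1).
  rewrite /v -[RHS]sumrB.
  under eq_bigr do rewrite -addrA -intS.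
  have := telescope_sumr (fun i => u (j + i%:Z)) (leq0n a).
  rewrite addr0 big_mkord => /(congr1 -%R).
  by rewrite opprB -sumrN => <-; apply: eq_bigr => i _; rewrite opprB.
rewrite (eq_esum (b := fun j => (v j - v (j + 1))%:E)); last first.
  by move=> j _; rewrite vE.
(* A window has [a] terms with a common limit; this is where limits along every shift [c] are
   used. *)
have cvgS (w : nat -> int) (m : R) : (forall c, u (w k + c) @[k --> \oo] --> m) ->
    v (w k) @[k --> \oo] --> a%:R * m.
  move=> cw; rewrite mulr_natl -[a in X in _ --> X]card_ord -sumr_const.
  by apply: cvg_big => [|i _]; [exact: add_continuous|exact: cw].
rewrite (@esum_telescope_int _ _ (a%:R * l) (a%:R * l')).
- by rewrite mulrBr.
- by move=> j; rewrite -subr_ge0 -vE subr_ge0.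
- exact: cvgS.
- exact: (cvgS (fun k => - k%:Z)).
Qed.

(** * Sums over an infinite binary tree *)

(** A word is a path read from the root: its first letter chooses a subtree, its last letter is the
    step from the parent node. *)
Definition act (X : Type) (step : bool -> X -> X) (p : X) (w : seq bool) : X :=
  foldl (fun q c => step c q) p w.

Fixpoint level_sum (R : realType) (X : Type) (step : bool -> X -> X)
    (g : X -> R) (k : nat) (p : X) : R :=
  if k is k'.+1 then
    level_sum step g k' (step false p) + level_sum step g k' (step true p)
  else g p.

Lemma act_rcons (X : Type) (step : bool -> X -> X) p w c :
  act step p (rcons w c) = step c (act step p w).
Proof. by rewrite /act foldl_rcons. Qed.

Lemma esum_level (R : realType) (X : Type) (step : bool -> X -> X)
    (g : X -> R) k p : (forall q, 0 <= g q) ->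
  (\esum_(w in [set w | size w = k]) (g (act step p w))%:E =
   (level_sum step g k p)%:E)%E.
Proof.
move=> g0; elim: k p => [|k IH] p.
  rewrite (_ : [set _ | _] = [set [::]]); last first.
    by apply/seteqP; split => w /=; [move/size0nil|move=> ->].
  by rewrite esum_set1 ?lee_fin.
(* The words of length [k.+1] are split by their first letter, each half being level [k] of a
   subtree. *)
rewrite (esumID [set w | head false w]); last by move=> w _; rewrite lee_fin.
rewrite (reindex_esum [set w | size w = k] _ (cons true)); last first.
  split; [by move=> w /= <-; split|by move=> v w _ _ []|].
  by move=> [//|[] w] [/= [sw]] // _; exists w.
rewrite (reindex_esum [set w | size w = k] (_ `&` ~` _) (cons false));
  last first.
  split; [by move=> w /= <-; split; [|exact/negP]|by move=> v w _ _ []|].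
  by move=> [//|[] w] [/= [sw]] // _; exists w.
by rewrite /act/= -!/(act _ _ _) !IH -EFinD addrC.
Qed.

Lemma level_sumB (R : realType) (X : Type) (step : bool -> X -> X)
    (S : set X) (g e : X -> R) k p :
  (forall c q, S q -> S (step c q)) ->
  (forall q, S q -> g q = e q - e (step false q) - e (step true q)) ->
  S p -> level_sum step g k p = level_sum step e k p - level_sum step e k.+1 p.
Proof.
move=> Sstep ge; elim: k p => [|k IH] p Sp; first by rewrite /= ge// opprD addrA.
by rewrite [LHS]/= !IH; [rewrite /=; ring|exact: Sstep|exact: Sstep].
Qed.

(** Grouped by length, the words contribute differences of consecutive level sums of [e], which
    telescope from [e p] to 0. The set [S] is an invariant of the steps on which the local identity
    holds. *)
Lemma esum_tree (R : realType) (X : Type) (step : bool -> X -> X)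
    (S : set X) (g e : X -> R) p :
  (forall c q, S q -> S (step c q)) ->
  (forall q, 0 <= g q) ->
  (forall q, S q -> g q = e q - e (step false q) - e (step true q)) ->
  S p -> level_sum step e k p @[k --> \oo] --> (0 : R) ->
  (\esum_(w in setT) (g (act step p w))%:E = (e p)%:E)%E.
Proof.
move=> Sstep g0 ge Sp cv.
rewrite (_ : setT = \bigcup_(k in setT) [set w : seq bool | size w = k]); last first.
  by apply/seteqP; split => w //= _; exists (size w).
rewrite esum_bigcupT; last 2 first.
- by move=> i j _ _ [w [/= <- <-]].
- by move=> w; rewrite lee_fin.
rewrite (eq_esum (b := fun k =>
  (level_sum step e k p - level_sum step e k.+1 p)%:E)); last first.
  by move=> k _; rewrite esum_level// (level_sumB _ Sstep ge).
rewrite (esum_telescope_nat _ cv) ?subr0// => k.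
rewrite -subr_ge0 -(level_sumB _ Sstep ge)//.
by elim: k p {Sp cv} => [|k IH] p //=; rewrite addr_ge0.
Qed.

(** * Integer vectors, dot product and determinant *)

Local Notation ivec := 'cV[int]_2.

Definition xc (x : ivec) : int := x 0 0.

Definition yc (x : ivec) : int := x 1 0.

Lemma coordD (x y : ivec) :
  (xc (x + y) = xc x + xc y) * (yc (x + y) = yc x + yc y).
Proof. by rewrite /xc /yc !mxE. Qed.

Lemma coordB (x y : ivec) :
  (xc (x - y) = xc x - xc y) * (yc (x - y) = yc x - yc y).
Proof. by rewrite /xc /yc !mxE. Qed.

Lemma coord_inj (x y : ivec) : xc x = xc y -> yc x = yc y -> x = y.
Proof.
rewrite /xc /yc => e0 e1; apply/matrixP => i k; rewrite (ord1 k).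
case: i => [[|[|//]] hi].
- by rewrite (_ : Ordinal hi = 0)//; exact/val_inj.
- by rewrite (_ : Ordinal hi = 1)//; exact/val_inj.
Qed.

Definition dot (x y : ivec) : int := xc x * xc y + yc x * yc y.

Definition cross (x y : ivec) : int := xc x * yc y - yc x * xc y.

(* The inverse of a step of the subtractive Euclidean algorithm. *)
Definition descend (c : bool) (p : ivec * ivec) : ivec * ivec :=
  if c then (p.1 + p.2, p.2) else (p.1, p.1 + p.2).

Lemma det_row_mx (x y : ivec) : \det (row_mx x y : 'M[int]_2) = cross x y.
Proof.
have E0 i : row_mx x y i 0 = x i 0.
  by rewrite -(row_mxEl x y); congr (row_mx _ _ _ _); exact/val_inj.
have E1 i : row_mx x y i 1 = y i 0.
  by rewrite -(row_mxEr x y); congr (row_mx _ _ _ _); exact/val_inj.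
move: (row_mx x y : 'M[int]_2) E0 E1 => M E0 E1.
have l00 : lift ord0 ord0 = 1 :> 'I_2 by exact/val_inj.
have l10 : lift 1 ord0 = 0 :> 'I_2 by exact/val_inj.
rewrite (expand_det_row _ 0) !big_ord_recl big_ord0 /cofactor !det_mx11 !mxE.
by rewrite !l00 !l10 !E0 !E1 /cross /xc /yc /=; ring.
Qed.

Lemma cross_descend (c : bool) p : cross (descend c p).1 (descend c p).2 = cross p.1 p.2.
Proof. by case: c; rewrite /cross /= !coordD; ring. Qed.

(** Lagrange's identity. *)
Lemma dot_cross (x y : ivec) :
  dot x x * dot y y = dot x y ^+ 2 + cross x y ^+ 2.
Proof. by rewrite /dot /cross; ring. Qed.

Lemma dot_ge1 (x y : ivec) : cross x y != 0 -> 1 <= dot x x /\ 1 <= dot y y.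
Proof.
move=> xy; have := dot_cross x y.
have x0 : 0 <= dot x x by rewrite /dot; nia.
have y0 : 0 <= dot y y by rewrite /dot; nia.
have : 0 < cross x y ^+ 2 by rewrite exprn_even_gt0.
have := sqr_ge0 (dot x y).
by split; nia.
Qed.

Lemma enorm_toR (R : realType) (x : ivec) :
  enorm (toR R x) ^+ 2 = (dot x x)%:~R.
Proof.
rewrite /enorm sqr_sqrtr ?sumr_ge0// => [|i _]; last exact: sqr_ge0.
rewrite !big_ord_recl big_ord0 addr0 !mxE /dot intrD !intrM.
rewrite !expr2; congr (_ * _ + _%:~R * _%:~R); congr (x _ _); exact/val_inj.
Qed.

(** * Weights and potentials on the tree of pairs *)

Definition weight (R : realType) (n : nat) (p : ivec * ivec) : R :=
  n%:R ^+ 2 / (enorm (toR R p.1) ^+ 2 * enorm (toR R p.2) ^+ 2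
               * enorm (toR R p.1 + toR R p.2) ^+ 2).

(** The cotangent of the angle of a pair is its dot product over its determinant, so for determinant
    [n] this is the angle excess divided by [2 * n]. *)
Definition potential (R : realType) (n : nat) (p : ivec * ivec) : R :=
  excess ((dot p.1 p.2)%:~R / n%:R) / (2 * n%:R).

Lemma weight_ge0 (R : realType) n p : 0 <= weight R n p.
Proof. by apply: divr_ge0; do ?[exact: sqr_ge0|apply: mulr_ge0]. Qed.

Lemma dot_descend c p : dot (descend c p).1 (descend c p).2 =
  dot p.1 p.2 + dot (if c then p.2 else p.1) (if c then p.2 else p.1).
Proof. by case: c; rewrite /dot /= !coordD; ring. Qed.

(** The diagonal [p.1 + p.2] cuts the angle of the pair in two. The two new cotangents add up to the
    squared length of the diagonal over [n], which is positive, so [acotD] applies. *)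
Lemma acot_descend (R : realType) (n : nat) p : (0 < n)%N ->
  cross p.1 p.2 = n%:Z ->
  acot ((dot p.1 p.2)%:~R / n%:R : R) =
  acot ((dot (descend false p).1 (descend false p).2)%:~R / n%:R) +
  acot ((dot (descend true p).1 (descend true p).2)%:~R / n%:R).
Proof.
move=> n0 pn; have n0R : (0 : R) < n%:R by rewrite ltr0n.
have [xx yy] : 1 <= dot p.1 p.1 /\ 1 <= dot p.2 p.2.
  by apply: dot_ge1; rewrite pn; lia.
have := dot_cross p.1 p.2; rewrite pn !dot_descend /=.
move: (dot p.1 p.2) (dot p.1 p.1) (dot p.2 p.2) xx yy => b a c a1 c1 /esym bac.
have pos : 0 < b + a + (b + c).
  have := sqr_ge0 (b + a); have := sqr_ge0 (b + c); nia.
have {}bac : b%:~R ^+ 2 + n%:R ^+ 2 = a%:~R * c%:~R :> R.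
  by rewrite -intrM -bac intrD !rmorphXn.
have {}pos : (0 : R) < b%:~R + a%:~R + (b%:~R + c%:~R).
  by rewrite -!intrD ltr0z.
rewrite acotD; last by rewrite -mulrDl divr_gt0// !intrD.
congr acot; rewrite !intrD.
move: bac pos; move: (a%:~R) (b%:~R) (c%:~R) (n%:R) n0R => A b' C N N0 bac pos.
have -> : (b' + A) / N * ((b' + C) / N) - 1 =
          ((b' + A) * (b' + C) - N ^+ 2) / N ^+ 2.
  by field; rewrite gt_eqF.
(* Lagrange's identity replaces [A * C - N ^+ 2] by [b' ^+ 2]. *)
have -> : (b' + A) * (b' + C) - N ^+ 2 = b' * (b' + A + (b' + C)).
  by move: bac => /(congr1 (fun z => z - b' ^+ 2)); nra.
by field; rewrite !gt_eqF.
Qed.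

(** The angles cancel by [acot_descend]. What is left is a rational identity in the squared lengths,
    the dot product and [n], tied together by Lagrange's identity. *)
Lemma weight_descend (R : realType) (n : nat) p : (0 < n)%N ->
  cross p.1 p.2 = n%:Z ->
  weight R n p =
  potential R n p - potential R n (descend false p)
    - potential R n (descend true p).
Proof.
move=> n0 pn; have n0R : (0 : R) < n%:R by rewrite ltr0n.
have [xx yy] : 1 <= dot p.1 p.1 /\ 1 <= dot p.2 p.2.
  by apply: dot_ge1; rewrite pn; lia.
have := acot_descend R n0 pn.
have := dot_cross p.1 p.2; rewrite pn.
have toRD : toR R p.1 + toR R p.2 = toR R (p.1 + p.2).
  by rewrite /toR map_mxD.
have dotD : dot (p.1 + p.2) (p.1 + p.2) =
    dot p.1 p.1 + 2 * dot p.1 p.2 + dot p.2 p.2.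
  by rewrite /dot !coordD; ring.
rewrite /weight toRD !enorm_toR dotD /potential /excess !dot_descend /=.
move: (dot p.1 p.2) (dot p.1 p.1) (dot p.2 p.2) xx yy => b a c a1 c1 /esym bac ->.
have pos : 0 < a + 2 * b + c.
  have := sqr_ge0 (b + a); have := sqr_ge0 (b + c); nia.
have {}bac : b%:~R ^+ 2 + n%:R ^+ 2 = a%:~R * c%:~R :> R.
  by rewrite -intrM -bac intrD !rmorphXn.
have {}pos : (0 : R) < a%:~R + 2 * b%:~R + c%:~R.
  by rewrite -[2]/(2%:~R) -intrM -!intrD ltr0z.
have {}a1 : (0 : R) < a%:~R by rewrite ltr0z; lia.
have {}c1 : (0 : R) < c%:~R by rewrite ltr0z; lia.
rewrite !intrD intrM.
move: bac pos a1 c1; move: (a%:~R) (b%:~R) (c%:~R) (n%:R) n0R => A B C N N0.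
move=> bac pos A0 C0.
(* For each of the three pairs, [1 + t ^+ 2] is the product of the two squared lengths over
   [N ^+ 2]; that of the diagonal is [A + 2 * B + C]. *)
have -> : 1 + (B / N) ^+ 2 = A * C / N ^+ 2.
  by rewrite -bac; field; rewrite gt_eqF.
have -> : 1 + ((B + A) / N) ^+ 2 = A * (A + 2 * B + C) / N ^+ 2.
  apply: (@mulIf _ (N ^+ 2)); first by rewrite gt_eqF ?exprn_gt0.
  rewrite divfK ?gt_eqF ?exprn_gt0// mulrDl -exprMn divfK ?gt_eqF//.
  by rewrite !mulrDr -bac; ring.
have -> : 1 + ((B + C) / N) ^+ 2 = C * (A + 2 * B + C) / N ^+ 2.
  apply: (@mulIf _ (N ^+ 2)); first by rewrite gt_eqF ?exprn_gt0.
  rewrite divfK ?gt_eqF ?exprn_gt0// mulrDl -exprMn divfK ?gt_eqF//.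
  by rewrite !mulrDr [C * A]mulrC -bac; ring.
have NE : N ^+ 2 = A * C - B ^+ 2 by rewrite -bac; ring.
have N20 : A * C - B ^+ 2 != 0 by rewrite -NE gt_eqF ?exprn_gt0.
rewrite NE; field: NE.
by rewrite N20 !gt_eqF.
Qed.

(* Each step adds a squared length, hence at least 1, to the dot product, so all
   the angles at depth [k] become uniformly small while their sum is constant. *)
Lemma level_sum_potential (R : realType) (n m k : nat) p : (0 < n)%N ->
  cross p.1 p.2 = n%:Z -> (0 < m)%N -> m%:Z <= dot p.1 p.2 + k%:Z ->
  0 <= level_sum descend (potential R n) k p
    <= acot ((dot p.1 p.2)%:~R / n%:R) / (2 * n%:R) * (n%:R / m%:R).
Proof.
move=> n0 pn m0; have n0R : (0 : R) < n%:R by rewrite ltr0n.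
have m0R : (0 : R) < m%:R by rewrite ltr0n.
elim: k p pn => [|k IH] p pn /=.
  rewrite addr0 => mb.
  have mbR : m%:R <= (dot p.1 p.2)%:~R :> R by rewrite -[m%:R]/(m%:Z%:~R) ler_int.
  have t0 : (0 : R) < (dot p.1 p.2)%:~R / n%:R.
    by rewrite divr_gt0// (lt_le_trans m0R).
  have /andP[lo hi] := excess_bounds t0.
  have d0 : (0 : R) < 2 * n%:R by rewrite mulr_gt0.
  rewrite /potential divr_ge0 ?(ltW d0)//= mulrAC ler_pM2r ?invr_gt0//.
  apply: le_trans hi _; rewrite ler_pM2l ?acot_gt0// invf_div.
  by rewrite ler_pM2l// lef_pV2 ?posrE// (lt_le_trans m0R).
move=> mb; have [xx yy] : 1 <= dot p.1 p.1 /\ 1 <= dot p.2 p.2.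
  by apply: dot_ge1; rewrite pn; lia.
have bnd c : m%:Z <= dot (descend c p).1 (descend c p).2 + k%:Z.
  by rewrite dot_descend; case: c; lia.
have cr c : cross (descend c p).1 (descend c p).2 = n by rewrite cross_descend.
have /andP[lo0 hi0] := IH _ (cr false) (bnd false).
have /andP[lo1 hi1] := IH _ (cr true) (bnd true).
rewrite (acot_descend R n0 pn) mulrDl mulrDl.
by apply/andP; split; [exact: addr_ge0|exact: lerD].
Qed.

Lemma level_sum_potential_cvg0 (R : realType) (n : nat) p : (0 < n)%N ->
  cross p.1 p.2 = n%:Z ->
  level_sum descend (potential R n) k p @[k --> \oo] --> (0 : R).
Proof.
move=> n0 pn; pose b := dot p.1 p.2.
(* At depth [k + |b| + 1] the level bound applies with [m = k + 1]. *)
rewrite -(cvg_shiftn `|b|.+1%N).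
apply: (@squeeze_cvgr _ _ _ _ (cst 0) (fun k =>
  acot (b%:~R / n%:R) / (2 * n%:R) * n%:R * harmonic k)).
- near=> k => /=; rewrite -[X in _ <= _ <= X]mulrA.
  by apply: level_sum_potential => //; rewrite -/b; lia.
- exact: cvg_cst.
- rewrite -[X in _ --> X](mulr0 (acot (b%:~R / n%:R) / (2 * n%:R) * n%:R)).
  by apply: cvgMr; exact: cvg_harmonic.
Unshelve. all: by end_near. Qed.

Lemma esum_weight_descend (R : realType) (n : nat) p : (0 < n)%N ->
  cross p.1 p.2 = n%:Z ->
  (\esum_(w in setT) (weight R n (act descend p w))%:E = (potential R n p)%:E)%E.
Proof.
move=> n0 pn.
apply: (@esum_tree _ _ _ [set q | cross q.1 q.2 = n%:Z]) => //.
- by move=> c q /= qn; rewrite cross_descend.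
- exact: weight_ge0.
- by move=> q; exact: weight_descend.
- exact: level_sum_potential_cvg0.
Qed.

(** The drop is the weight of [p] plus the potential of the other child, and that potential is a sum
    of nonnegative weights. *)
Lemma potential_descend_le (R : realType) (n : nat) p : (0 < n)%N ->
  cross p.1 p.2 = n%:Z -> potential R n (descend false p) <= potential R n p.
Proof.
move=> n0 pn.
have : 0 <= potential R n (descend true p).
  rewrite -lee_fin -esum_weight_descend ?cross_descend//.
  by apply: esum_ge0 => w _; rewrite lee_fin weight_ge0.
have := weight_descend R n0 pn; have := weight_ge0 R n p.
by lra.
Qed.

(** * Euclidean descent on [B n] *)

Lemma H_coord (x : ivec) : H x <-> 0 < yc x \/ yc x = 0 /\ 0 <= xc x.
Proof.
change (0 <= yc x /\ ~ (xc x < 0 /\ yc x = 0) <->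
  0 < yc x \/ yc x = 0 /\ 0 <= xc x).
by lia.
Qed.

Lemma B_cross (n : nat) p : B n p <-> [/\ H p.1, H p.2 & cross p.1 p.2 = n%:Z].
Proof. by rewrite /B /= det_row_mx. Qed.

(** A horizontal vector of [H] does not point left; as second vector it would make the determinant
    at most 0. *)
Lemma B_bounds (n : nat) p : (0 < n)%N -> B n p ->
  [/\ 0 <= yc p.1, 0 < yc p.2 & yc p.1 = 0 -> 0 < xc p.1].
Proof.
by move=> n0 /B_cross[/H_coord hx /H_coord hy]; rewrite /cross => c; split; nia.
Qed.

Lemma B_descend (n : nat) c p : (0 < n)%N -> B n p -> B n (descend c p).
Proof.
move=> n0 Bp; have [x0 y0 _] := B_bounds n0 Bp.
have /B_cross[hx hy pn] := Bp; apply/B_cross; rewrite cross_descend.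
have hxy : H (p.1 + p.2) by apply/H_coord; rewrite ?coordB ?coordD; lia.
by case: c.
Qed.

(** The heights of the image reveal the step: after [false] the second vector is strictly higher,
    after [true] it is not. *)
Lemma descend_inj (n : nat) c c' p q : (0 < n)%N -> B n p -> B n q ->
  descend c p = descend c' q -> c = c' /\ p = q.
Proof.
move=> n0 Bp Bq.
have [x0 y0 _] := B_bounds n0 Bp; have [x0' y0' _] := B_bounds n0 Bq.
case: p q {Bp Bq} x0 y0 x0' y0' => [x y] [x' y'] /= x0 y0 x0' y0'.
case: c c' => [] [] [] //=.
- by move=> /[swap] -> /addIr ->.
- move=> e1 e2; have := congr1 yc e1.
  by have := congr1 yc e2; rewrite ?coordB ?coordD; lia.
- move=> e1 e2; have := congr1 yc e1.
  by have := congr1 yc e2; rewrite ?coordB ?coordD; lia.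
- by move=> -> /addrI ->.
Qed.

(** The step [false] preserves this set and [true] leaves it, so the trees covering the rest of
    [B n] are rooted at [descend true q] with [q] in [B0 n]. *)
Definition B0 (n : nat) : set (ivec * ivec) := B n `&` [set p : ivec * ivec | yc p.1 = 0].

Lemma act_B (n : nat) p w : (0 < n)%N -> B n p ->
  B n (act descend (descend true p) w) /\
  0 < yc (act descend (descend true p) w).1.
Proof.
move=> n0 Bp; elim/last_ind: w => [|w c [Bw w0]].
  have [x0 y0 _] := B_bounds n0 Bp.
  by split; [exact: B_descend|rewrite /= ?coordB ?coordD; lia].
rewrite act_rcons; split; first exact: B_descend.
have [_ y0 _] := B_bounds n0 Bw.
move: (act _ _ _) Bw w0 y0 => q _ w0 y0.
by case: c; rewrite //= coordD; lia.
Qed.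

(** Letters are recovered from the end. The words run out together, because a node of a tree has a
    first vector of positive height while [p] and [q] have a horizontal one. *)
Lemma act_inj (n : nat) p q v w : (0 < n)%N -> B0 n p -> B0 n q ->
  act descend (descend true p) v = act descend (descend true q) w ->
  p = q /\ v = w.
Proof.
move=> n0 [Bp /= p0] [Bq /= q0].
elim/last_ind: v w => [|v c IH] w; case/lastP: w => [|w c'].
- by move=> e; have [] := @descend_inj n true true p q n0 Bp Bq e.
- have [Bw w0] := act_B w n0 Bq.
  rewrite act_rcons => e; have [_ pE] := @descend_inj n true _ p _ n0 Bp Bw e.
  by move: w0; rewrite -pE p0.
- have [Bv v0] := act_B v n0 Bp.
  rewrite act_rcons => e; have [_ qE] := @descend_inj n _ true _ q n0 Bv Bq e.
  by move: v0; rewrite qE q0.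
- have [Bw w0] := act_B w n0 Bq; have [Bv v0] := act_B v n0 Bp.
  by rewrite !act_rcons => e; have [-> /IH[-> ->]] := descend_inj n0 Bv Bw e.
Qed.

(** The subtractive Euclidean algorithm on the heights, by induction on their sum: the lower vector
    is subtracted from the higher one until the first is horizontal. *)
Lemma act_surj (n : nat) p : (0 < n)%N -> B n p -> yc p.1 != 0 ->
  exists2 q, B0 n q & exists w, p = act descend (descend true q) w.
Proof.
move=> n0; have [N] := ubnP (absz (yc p.1 + yc p.2)).
elim: N p => // N IH [x y] /= leN Bp x10.
have [x0 y0 _] := B_bounds n0 Bp; rewrite /= in x0 y0.
have /B_cross[/= /H_coord hx /H_coord hy pn] := Bp.
have [xy|yx] := ltP (yc x) (yc y).
  have Bq : B n (x, y - x).
    apply/B_cross; split => /=; [exact/H_coord| |].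
      by apply/H_coord; rewrite ?coordB ?coordD; lia.
    by move: pn; rewrite /cross ?coordB ?coordD; lia.
  have [|q Bq0 [w qE]] := IH (x, y - x) _ Bq x10.
    by rewrite /= ?coordB ?coordD; lia.
  exists q => //; exists (rcons w false).
  by rewrite act_rcons -qE /descend /= addrC subrK.
have Bq : B n (x - y, y).
  apply/B_cross; split => /=; [|exact/H_coord|].
    move: pn; rewrite /cross => pn; apply/H_coord; rewrite !coordB.
    (* For equal heights [x - y] is horizontal, and the positive determinant makes it point right,
       hence lie in [H]. *)
    have [e|ne] := eqVneq (yc x) (yc y); last by lia.
    by right; rewrite e in pn *; nia.
  by move: pn; rewrite /cross ?coordB ?coordD; lia.
have pE : (x, y) = descend true (x - y, y) by rewrite /descend /= subrK.
have [e|ne] := eqVneq (yc (x - y)) 0.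
  by exists (x - y, y) => //; exists [::].
have [|q Bq0 [w qE]] := IH (x - y, y) _ Bq ne.
  by move: ne; rewrite /= ?coordB ?coordD; lia.
by exists q => //; exists (rcons w true); rewrite act_rcons -qE.
Qed.

(** Each [p] in [B0 n] contributes its own weight and the tree below [descend true p], which sums to
    the potential of its root; [weight_descend] turns the total into the stated difference. *)
Lemma esum_B (R : realType) (n : nat) : (0 < n)%N ->
  (\esum_(p in B n) (weight R n p)%:E =
   \esum_(p in B0 n) (potential R n p - potential R n (descend false p))%:E)%E.
Proof.
move=> n0; rewrite (esumID [set p : ivec * ivec | yc p.1 = 0]); last first.
  by move=> p _; rewrite lee_fin weight_ge0.
rewrite -/(B0 n).
rewrite (reindex_esum (B0 n `*`` (fun=> setT)) (_ `&` ~` _)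
  (fun k => act descend (descend true k.1) k.2)); last first.
  split.
  - move=> [p w] /= [[Bp _] _]; have [Bw w0] := act_B w n0 Bp.
    by split=> //= e; rewrite e in w0.
  - move=> [p v] [q w]; rewrite !inE /= => -[Bp _] [Bq _] /(act_inj n0 Bp Bq).
    by move=> [-> ->].
  - move=> p [Bp /= /eqP p0]; have [q Bq [w ->]] := act_surj n0 Bp p0.
    by exists (q, w).
rewrite -(@esum_esum _ _ _ (B0 n) (fun=> setT)
  (fun p w => (weight R n (act descend (descend true p) w))%:E)); last first.
  by move=> p w _ _; rewrite lee_fin weight_ge0.
rewrite -esumD.
- apply: eq_esum => p [/B_cross[_ _ pn] _].
  rewrite esum_weight_descend ?cross_descend// -EFinD; congr EFin.
  by rewrite weight_descend//; ring.
- by move=> p _; rewrite lee_fin weight_ge0.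
- by move=> p _; apply: esum_ge0 => w _; rewrite lee_fin weight_ge0.
Qed.

(** * Pairs with horizontal first vector *)

Definition ray (n a : nat) (j : int) : ivec * ivec :=
  (\col_i (if i == 0 then a%:Z else 0),
   \col_i (if i == 0 then j else (n %/ a)%N%:Z)).

Lemma ray_coord (n a : nat) j :
  (xc (ray n a j).1 = a%:Z) * (yc (ray n a j).1 = 0) *
  (xc (ray n a j).2 = j) * (yc (ray n a j).2 = (n %/ a)%N%:Z).
Proof. by rewrite /xc /yc /= !mxE. Qed.

Lemma dot_ray (n a : nat) j : dot (ray n a j).1 (ray n a j).2 = a%:Z * j.
Proof. by rewrite /dot !ray_coord mul0r addr0. Qed.

Lemma descend_ray (n a : nat) j : descend false (ray n a j) = ray n a (j + a%:Z).
Proof.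
by congr pair; apply: coord_inj; rewrite ?coordD !ray_coord ?add0r// addrC.
Qed.

Lemma ray_B0 (n a : nat) j : (0 < n)%N -> (a %| n)%N -> B0 n (ray n a j).
Proof.
move=> n0 an; have a0 : (0 < a)%N by exact: dvdn_gt0 an.
have d0 : (0 < n %/ a)%N by rewrite divn_gt0// dvdn_leq.
split; last by rewrite /= ray_coord.
apply/B_cross; split; [by apply/H_coord; rewrite !ray_coord; lia..|].
by rewrite /cross !ray_coord mul0r subr0 -PoszM mulnC divnK.
Qed.

Lemma esum_B0 (R : realType) (n : nat) (f : ivec * ivec -> \bar R) :
  (0 < n)%N -> (forall p, B0 n p -> (0 <= f p)%E) ->
  (\esum_(p in B0 n) f p =
   \sum_(a <- divisors n) \esum_(j in setT) f (ray n a j))%E.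
Proof.
move=> n0 f0.
have finD : finite_set [set` divisors n] by exact: finite_seq.
transitivity (\esum_(a in [set` divisors n]) \esum_(j in setT) f (ray n a j))%E.
  rewrite (esum_esum (J := fun=> setT) (a := fun a j => f (ray n a j))).
    apply: reindex_esum; split.
    - by move=> [a j] /= [an _]; apply: ray_B0 => //; rewrite dvdn_divisors.
    - move=> [a j] [b k] _ _ /= e.
      have := congr1 (fun p : ivec * ivec => xc p.1) e.
      have := congr1 (fun p : ivec * ivec => xc p.2) e.
      by rewrite !ray_coord => -> [->].
    - move=> [x y] Bxy; have [/B_bounds/= /(_ n0)[_ y0 /[swap] /= x1 /(_ x1) x0]] := Bxy.
      have [/B_cross[_ _] /=] := Bxy; rewrite /cross x1 mul0r subr0 => xy _.
      (* With [x] horizontal the determinant is [xc x * yc y], so the length of [x] divides [n] and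
         fixes the height of [y]. *)
      have nE : n = (`|xc x| * `|yc y|)%N by rewrite -abszM xy.
      exists (absz (xc x), xc y) => /=.
        by split => //; rewrite -dvdn_divisors// nE dvdn_mulr.
      have yE : (n %/ absz (xc x))%N = yc y :> int.
        by rewrite nE mulKn; lia.
      rewrite [LHS]surjective_pairing.
      congr pair; apply: coord_inj; rewrite ?ray_coord ?yE ?x1//=.
      by lia.
  move=> a j; rewrite /= -dvdn_divisors// => an _.
  by apply: f0; exact: ray_B0.
rewrite esum_fset//; last first.
  move=> a; rewrite inE /= -dvdn_divisors// => an.
  by apply: esum_ge0 => j _; apply: f0; exact: ray_B0.
by apply/esym/fsbig_seq/divisors_uniq.
Qed.

(** The cotangent along the ray is [a * j / n], so the excess tends to 0 as [j] grows and to pi as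
    [j] decreases; the window length [a] supplies the factor [a]. *)
Lemma esum_ray (R : realType) (n a : nat) : (0 < n)%N -> (a %| n)%N ->
  (\esum_(j in setT)
     (potential R n (ray n a j) - potential R n (descend false (ray n a j)))%:E
   = (a%:R * (pi / (2 * n%:R)))%:E)%E.
Proof.
move=> n0 an; have a0 : (0 < a)%N by exact: dvdn_gt0 an.
have n0R : (0 : R) < n%:R by rewrite ltr0n.
have d0 : (0 : R) < a%:R / n%:R by rewrite divr_gt0 ?ltr0n.
pose u j := potential R n (ray n a j).
have uE j : u j = excess (a%:R / n%:R * j%:~R) / (2 * n%:R).
  by rewrite /u /potential dot_ray intrM mulrAC.
rewrite (eq_esum (b := fun j => (u j - u (j + a%:Z))%:E)); last first.
  by move=> j _; rewrite descend_ray.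
rewrite (@esum_telescope_step _ _ _ 0 (pi / (2 * n%:R))) ?subr0//.
- move=> j; have [/B_cross[_ _ jn] _] := ray_B0 j n0 an.
  by have := potential_descend_le R n0 jn; rewrite descend_ray.
- move=> c; have -> : (fun k : nat => u (k%:Z + c)) =
    (fun k => excess (a%:R / n%:R * (k%:Z + c)%:~R) / (2 * n%:R)).
    by apply/funext => k; rewrite uE.
  rewrite -[X in _ --> X](mul0r (2 * n%:R)^-1).
  by apply: cvgMl; exact: excess_cvg0.
- move=> c; have -> : (fun k : nat => u (- k%:Z + c)) =
    (fun k => (pi - excess (a%:R / n%:R * (k%:Z - c)%:~R)) / (2 * n%:R)).
    (* Reflecting the angle turns the limit at minus infinity into one at plus infinity, with shift
       [- c]. *)
    by apply/funext => k; rewrite uE -excessN -mulrN -rmorphN opprB addrC.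
  rewrite -[in X in _ --> X](subr0 pi).
  apply: cvgMl; apply: cvgB; first exact: cvg_cst.
  exact: excess_cvg0.
Qed.

Theorem theorem3 (R : realType) (n : nat) (hn : (0 < n)%N) :
  (\esum_(p in B n)
     (n%:R ^+ 2 / (enorm (toR R p.1) ^+ 2 * enorm (toR R p.2) ^+ 2
                   * enorm (toR R p.1 + toR R p.2) ^+ 2))%:E
   = (1 / 2 * (pi / n%:R) * (sigma1 n)%:R)%:E)%E.
Proof.
rewrite -/(weight R n _) (esum_B R hn) esum_B0//; last first.
  move=> p [/B_cross[_ _ pn] _].
  by rewrite lee_fin subr_ge0 potential_descend_le.
rewrite big_seq (eq_bigr (fun a => (a%:R * (pi / (2 * n%:R)))%:E)); last first.
  by move=> a; rewrite -dvdn_divisors// => an; exact: esum_ray.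
rewrite -big_seq sumEFin; congr EFin.
rewrite -mulr_suml -natr_sum /sigma1 mulrC; field.
by rewrite pnatr_eq0 -lt0n.
Qed.
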